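(* For all integers $n \geq 2$ and $k \geq 3$, the map $T_k$ restricts to bijections of the spaces of $k$-spirals of each type: $T_k(\mathcal{S}_{k,n}^\alpha) = \mathcal{S}_{k,n}^\alpha$ and $T_k(\mathcal{S}_{k,n}^\beta) = \mathcal{S}_{k,n}^\beta$. Equivalently, both $T_k$ and $T_k^{-1}$ map $\mathcal{S}_{k,n}^\alpha$ into $\mathcal{S}_{k,n}^\alpha$ and $\mathcal{S}_{k,n}^\beta$ into $\mathcal{S}_{k,n}^\beta$.
   Context: The affine patch $\mathbb{A}^2=\{[x:y:1]\}\subset\mathbb{RP}^2$ is identified with $\mathbb{R}^2$ via $(x,y)\mapsto[x:y:1]$. For $V_1,V_2,V_3\in\mathbb{A}^2$ with affine coordinates $\tilde V_j=(x_j,y_j,1)$, set $\mathcal{O}(V_1,V_2,V_3)=\det(\tilde V_1,\tilde V_2,\tilde V_3)$ (the $3\times3$ matrix with these columns); the ordered triple $(V_1,V_2,V_3)$ is called positive if $\mathcal{O}(V_1,V_2,V_3)>0$. $\operatorname{int}(V_1,V_2,V_3)$ denotes the interior of the affine triangle with vertices $V_1,V_2,V_3$. A twisted $n$-gon is a map $P:\mathbb{Z}\to\mathbb{RP}^2$ such that every three consecutive points $P_i,P_{i+1},P_{i+2}$ are not collinear, together with a projective transformation $M\in\mathrm{PGL}_3(\mathbb{R})$ (the monodromy) with $P_{i+n}=M(P_i)$ for all $i$. Two twisted $n$-gons $P,Q$ are equivalent if there is $\phi\in\mathrm{PGL}_3(\mathbb{R})$ with $\phi(P_i)=Q_i$ for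 all $i$; $\mathcal{P}_n$ is the set of equivalence classes $[P]$. $P$ is $k$-nice if for every $i$ the four points $P_i,P_{i+1},P_{i+k},P_{i+k+1}$ are in general position (no three collinear); this is invariant under equivalence. For $k\ge3$, a class $[P]\in\mathcal{P}_n$ is a $k$-spiral of type $\alpha$ (resp. type $\beta$) if it is $k$-nice and for every $N\in\mathbb{Z}$ there exists a representative $P$ such that for all $i\ge N$: $P_i\in\mathbb{A}^2$, $(P_i,P_{i+1},P_{i+2})$ is positive, and for type $\alpha$: $(P_i,P_{i+1},P_{i+k+1})$ is positive and $P_{i+k}\in\operatorname{int}(P_i,P_{i+1},P_{i+k+1})$; for type $\beta$: $(P_i,P_{i+1},P_{i+k})$ is positive and $P_{i+k+1}\in\operatorname{int}(P_i,P_{i+1},P_{i+k})$. Such a $P$ is called an $N$-representative of type $\alpha$ (resp. $\beta$). $\mathcal{S}_{k,n}^\alpha$, $\mathcal{S}_{k,n}^\beta$ denote the sets of $k$-spirals of type $\alpha$, $\beta$. For a $k$-nice twisted $n$-gon $P$, $T_k(P)=P'$ is defined by $P'_i = P_iP_{i+k}\cap P_{i+1}P_{i+k+1}$ (intersection of the lines through the indicated points); $P'$ is again a $k$-nice twisted $n$-gon, $T_k$ commutes with projective transformations and so acts on classes of $k$-nice twisted $n$-gons, with inverse given by $P_i=P'_{i-k-1}P'_{i-k}\cap P'_{i-1}P'_i$. *)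

(* Defs.v *)
From HB Require Import structures.
From mathcomp Require Import all_boot all_order all_algebra.
From mathcomp Require Import reals.
Set Implicit Arguments. Unset Strict Implicit. Unset Printing Implicit Defensive.
Import Order.TTheory GRing.Theory Num.Theory.
Local Open Scope ring_scope.

Section Spirals.
Variable R : realType.

(* Points of RP^2 are represented by nonzero homogeneous coordinate vectors. *)
Definition pt := 'cV[R]_3.

Definition proj_eq (u v : pt) : Prop := exists c : R, c != 0 /\ u = c *: v.

Definition mx3 (u v w : pt) : 'M[R]_3 :=
  \matrix_(i < 3, j < 3)
    (if val j == 0%N then u i 0 else if val j == 1%N then v i 0 else w i 0).
Definition det3 (u v w : pt) : R := \det (mx3 u v w).

Definition collinear (u v w : pt) : Prop := det3 u v w = 0.

Definition polygon := int -> pt.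

Definition twisted_ngon (n : nat) (P : polygon) : Prop :=
  (forall i, P i != 0) /\
  (forall i, ~ collinear (P i) (P (i + 1)) (P (i + 2))) /\
  exists M : 'M[R]_3, M \in unitmx /\
    forall i, proj_eq (P (i + n%:Z)) (M *m P i).

Definition equiv_poly (P Q : polygon) : Prop :=
  exists phi : 'M[R]_3, phi \in unitmx /\
    forall i, proj_eq (phi *m P i) (Q i).

Definition gen_pos4 (a b c d : pt) : Prop :=
  ~ collinear a b c /\ ~ collinear a b d /\ ~ collinear a c d /\ ~ collinear b c d.

Definition k_nice (k : nat) (P : polygon) : Prop :=
  forall i, gen_pos4 (P i) (P (i + 1)) (P (i + k%:Z)) (P (i + k%:Z + 1)).

Definition in_affine (v : pt) : Prop := v 2%:R 0 != 0.
Definition aff (v : pt) : pt := (v 2%:R 0)^-1 *: v.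

Definition orient (u v w : pt) : R := det3 (aff u) (aff v) (aff w).
Definition positive_triple (u v w : pt) : Prop := 0 < orient u v w.

Definition in_int_tri (p a b c : pt) : Prop :=
  exists la lb lc : R, 0 < la /\ 0 < lb /\ 0 < lc /\ la + lb + lc = 1 /\
    aff p = la *: aff a + lb *: aff b + lc *: aff c.

Definition N_rep_alpha (k : nat) (N : int) (Q : polygon) : Prop :=
  forall i, N <= i ->
    in_affine (Q i) /\
    positive_triple (Q i) (Q (i + 1)) (Q (i + 2)) /\
    positive_triple (Q i) (Q (i + 1)) (Q (i + k%:Z + 1)) /\
    in_int_tri (Q (i + k%:Z)) (Q i) (Q (i + 1)) (Q (i + k%:Z + 1)).

Definition N_rep_beta (k : nat) (N : int) (Q : polygon) : Prop :=
  forall i, N <= i ->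
    in_affine (Q i) /\
    positive_triple (Q i) (Q (i + 1)) (Q (i + 2)) /\
    positive_triple (Q i) (Q (i + 1)) (Q (i + k%:Z)) /\
    in_int_tri (Q (i + k%:Z + 1)) (Q i) (Q (i + 1)) (Q (i + k%:Z)).

(* [P] belongs to S^alpha_{k,n} / S^beta_{k,n} (a class-invariant property). *)
Definition spiral_alpha (k n : nat) (P : polygon) : Prop :=
  twisted_ngon n P /\ k_nice k P /\
  forall N : int, exists Q, equiv_poly P Q /\ N_rep_alpha k N Q.

Definition spiral_beta (k n : nat) (P : polygon) : Prop :=
  twisted_ngon n P /\ k_nice k P /\
  forall N : int, exists Q, equiv_poly P Q /\ N_rep_beta k N Q.

(* Q = T_k(P) (up to rescaling lifts): Q_i is the (nonzero) intersection point
   of the lines P_i P_{i+k} and P_{i+1} P_{i+k+1}. *)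
Definition is_Tk (k : nat) (P Q : polygon) : Prop :=
  forall i, Q i != 0 /\
    collinear (P i) (P (i + k%:Z)) (Q i) /\
    collinear (P (i + 1)) (P (i + k%:Z + 1)) (Q i).

End Spirals.

(* Main.v *)
Require Import Defs.
From HB Require Import structures.
From mathcomp Require Import all_boot all_order all_algebra.
From mathcomp Require Import reals.
From mathcomp Require Import ring zify.
Import Order.TTheory GRing.Theory Num.Theory.
Local Open Scope ring_scope.

(** In an affine chart both types of spiral read
      P_{i+k} = a P_i + b P_{i+1} + c P_{i+k+1},   c > 0,  s a > 0,  s b > 0,
    with [P_i, P_{i+1}, P_{i+k+1}] > 0 and [P_i, P_{i+1}, P_{i+2}] > 0, where s = 1
    for type alpha and s = -1 for type beta.  Hence
      T_k(P)_i = P_{i+k} - a P_i = b P_{i+1} + c P_{i+k+1},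
      T_k^{-1}(P)_{i+k+1} = s (a P_i + b P_{i+1}) = s (P_{i+k} - c P_{i+k+1}),
    and the interior conditions for the image follow by eliminating the common
    points of consecutive lines.  The orientations then reduce to the signs of
    X = [P_j, P_{j+k}, P_{j+2k}] and Y = [P_{j+k-1}, P_{j+k}, P_{j+k+1}]: a
    three-term Pluecker relation at P_{j+k} gives s X Y > 0.  For T_k one knows
    Y > 0 and needs s X > 0; for the inverse it is the other way round. *)

(** * Determinants in coordinates *)

Section Coordinates.
Set Implicit Arguments. Unset Strict Implicit. Unset Printing Implicit Defensive.
Variable R : realType.
Implicit Types (u v w : pt R).

Lemma pt_ext u v : u 0 0 = v 0 0 -> u 1 0 = v 1 0 -> u 2%:R 0 = v 2%:R 0 -> u = v.
Proof.
move=> e0 e1 e2; apply/colP => -[[|[|[|//]]] lt_i3].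
- by rewrite (_ : Ordinal _ = 0) //; apply: val_inj.
- by rewrite (_ : Ordinal _ = 1) //; apply: val_inj.
- by rewrite (_ : Ordinal _ = 2%:R) //; apply: val_inj.
Qed.

Lemma det3E u v w : det3 u v w =
  u 0 0 * (v 1 0 * w 2%:R 0 - v 2%:R 0 * w 1 0)
  - u 1 0 * (v 0 0 * w 2%:R 0 - v 2%:R 0 * w 0 0)
  + u 2%:R 0 * (v 0 0 * w 1 0 - v 1 0 * w 0 0).
Proof.
rewrite /det3 (expand_det_row _ 0) !big_ord_recl big_ord0 /cofactor.
rewrite !(expand_det_row _ 0) !big_ord_recl !big_ord0 /cofactor !det_mx11 !mxE /=.
have -> : lift 0 0 = 1 :> 'I_3 by apply: val_inj.
have -> : lift 0 (lift 0 0) = 2%:R :> 'I_3 by apply: val_inj.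
rewrite /bump /=; ring.
Qed.

End Coordinates.

Ltac bracket := rewrite ?det3E ?mxE; ring.

(** * Bracket identities and projective equivalence *)

Section Brackets.
Set Implicit Arguments. Unset Strict Implicit. Unset Printing Implicit Defensive.
Variable R : realType.
Implicit Types (u v w x y : pt R) (a b c : R).

Lemma det3_mulmx (A : 'M[R]_3) u v w :
  det3 (A *m u) (A *m v) (A *m w) = \det A * det3 u v w.
Proof.
rewrite /det3 -det_mulmx; congr (\det _); apply/matrixP => i j; rewrite !mxE.
by case: j => [[|[|[|//]]] ?] /=; apply: eq_bigr => l _; rewrite !mxE.
Qed.

Lemma det3Zl a u v w : det3 (a *: u) v w = a * det3 u v w.
Proof. by bracket. Qed.

Lemma det3Zm a u v w : det3 u (a *: v) w = a * det3 u v w.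
Proof. by bracket. Qed.

Lemma det3Zr a u v w : det3 u v (a *: w) = a * det3 u v w.
Proof. by bracket. Qed.

Lemma det3_cramer u v w x :
  det3 u v w *: x = det3 x v w *: u + det3 u x w *: v + det3 u v x *: w.
Proof. by apply: pt_ext; bracket. Qed.

Lemma det3_swap_neq0 u v w : det3 u v w != 0 -> det3 u w v != 0 /\ det3 v u w != 0.
Proof.
have -> : det3 u w v = - det3 u v w by bracket.
have -> : det3 v u w = - det3 u v w by bracket.
by rewrite oppr_eq0.
Qed.

(** All six brackets contain [C]: projecting from [C] leaves the three-term relation between the 2 x
    2 minors of [A], [D], [E], [Y]. *)
Lemma det3_plucker (A C D E Y : pt R) :
  det3 A C E * det3 Y C D = det3 A C D * det3 Y C E + det3 A C Y * det3 C D E.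
Proof. by bracket. Qed.

Lemma collinearNE u v w : ~ collinear u v w <-> det3 u v w != 0.
Proof. by split=> [/eqP|/eqP]. Qed.

Lemma proj_eq_refl u : proj_eq u u.
Proof. by exists 1; rewrite oner_eq0 scale1r. Qed.

Lemma proj_eq_sym u v : proj_eq u v -> proj_eq v u.
Proof.
case=> c [c0 ->]; exists c^-1; rewrite invr_eq0; split=> //.
by rewrite scalerA mulVf // scale1r.
Qed.

Lemma proj_eq_trans v u w : proj_eq u v -> proj_eq v w -> proj_eq u w.
Proof.
case=> c [c0 ->] [d [d0 ->]]; exists (c * d).
by rewrite mulf_neq0 // scalerA.
Qed.

Lemma mulmx_unit_neq0 (phi : 'M[R]_3) u : phi \in unitmx -> u != 0 -> phi *m u != 0.
Proof. by move=> phiU; apply: contra_neq => phiu0; rewrite -(mulKmx phiU u) phiu0 mulmx0. Qed.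

Lemma collinear_map (phi : 'M[R]_3) u v w u' v' w' : phi \in unitmx ->
  proj_eq (phi *m u) u' -> proj_eq (phi *m v) v' -> proj_eq (phi *m w) w' ->
  collinear u v w <-> collinear u' v' w'.
Proof.
rewrite unitmxE unitfE /collinear => phi0 [a [a0 ea]] [b [b0 eb]] [c [c0 ec]].
have := det3_mulmx phi u v w; rewrite ea eb ec det3Zl det3Zm det3Zr => e.
split=> /eqP e0; apply/eqP; move/eqP: e.
  by rewrite (eqP e0) mulr0 !mulf_eq0 (negPf a0) (negPf b0) (negPf c0).
by rewrite (eqP e0) !mulr0 eq_sym mulf_eq0 (negPf phi0).
Qed.

(** * Intersection points of two lines *)

Definition meets (a b c d x : pt R) : Prop := collinear a b x /\ collinear c d x.

(** This is the cross product of the two lines, (c x d) x (a x b), expanded along [a] and [b]. *)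
Definition meet (a b c d : pt R) : pt R := det3 c d b *: a - det3 c d a *: b.

Lemma meets_meet (a b c d : pt R) : meets a b c d (meet a b c d).
Proof. by split; rewrite /collinear /meet; bracket. Qed.

Lemma meet_neq0 (a b c d : pt R) : det3 a c b != 0 -> det3 c b d != 0 -> meet a b c d != 0.
Proof.
move=> acb cbd; apply/eqP => m0.
have : det3 (meet a b c d) b c = 0 by rewrite m0; bracket.
have -> : det3 (meet a b c d) b c = det3 a c b * det3 c b d by rewrite /meet; bracket.
by move/eqP; rewrite mulf_eq0 (negPf acb) (negPf cbd).
Qed.

(** Each common point of the two lines is compared with [meet]: Cramer's rule in the basis [a], [c],
    [b] has no [c] term, and incidence with the line [c d] fixes the ratio of the other two. *)
Lemma meets_uniq (a b c d x y : pt R) : det3 a c b != 0 -> det3 c b d != 0 ->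
  x != 0 -> y != 0 -> meets a b c d x -> meets a b c d y -> proj_eq x y.
Proof.
move=> acb cbd.
suff key z : z != 0 -> meets a b c d z -> proj_eq z (meet a b c d).
  move=> x0 y0 mx my; apply: proj_eq_trans (key _ x0 mx) _.
  exact: proj_eq_sym (key _ y0 my).
move=> z0 [abz cdz].
have e : (det3 a c b * det3 c b d) *: z = det3 z b c *: meet a b c d.
  have e1 : det3 a c b *: z = det3 z c b *: a + det3 a c z *: b.
    by rewrite det3_cramer (_ : det3 a z b = 0) ?scale0r ?addr0 // -[RHS]oppr0 -abz; bracket.
  have e2 : det3 z c b * det3 c d a + det3 a c z * det3 c d b = 0.
    have : det3 c d (det3 a c b *: z) = 0 by rewrite det3Zr cdz mulr0.
    by rewrite e1 => <-; bracket.
  rewrite mulrC -scalerA e1 /meet scalerBr scalerDr !scalerA.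
  have -> : det3 c b d * det3 z c b = det3 z b c * det3 c d b by bracket.
  have -> : det3 c b d * det3 a c z = - (det3 z b c * det3 c d a).
    transitivity (- (det3 a c z * det3 c d b)); first by bracket.
    by rewrite -[RHS]subr0 -e2; bracket.
  by rewrite scaleNr.
have h0 : det3 a c b * det3 c b d != 0 by rewrite mulf_neq0.
exists ((det3 a c b * det3 c b d)^-1 * det3 z b c); split.
  rewrite mulf_neq0 ?invr_eq0 //; apply: contraNneq z0 => h1.
  by move/eqP: e; rewrite h1 scale0r scaler_eq0 (negPf h0).
by rewrite -scalerA -e scalerA mulVf // scale1r.
Qed.

(** Transports intersection points along a projective map; it serves both for the monodromy and for
    the change of representative. *)
Lemma meets_map_uniq (phi : 'M[R]_3) (a b c d x a' b' c' d' x' : pt R) :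
  phi \in unitmx ->
  proj_eq (phi *m a) a' -> proj_eq (phi *m b) b' ->
  proj_eq (phi *m c) c' -> proj_eq (phi *m d) d' ->
  det3 a c b != 0 -> det3 c b d != 0 -> x != 0 -> x' != 0 ->
  meets a b c d x -> meets a' b' c' d' x' -> proj_eq (phi *m x) x'.
Proof.
move=> phiU pa pb pc pd acb cbd x0 x'0 [abx cdx] m'.
apply: (@meets_uniq a' b' c' d') => //.
- by apply/collinearNE; rewrite -(collinear_map phiU pa pc pb); apply/collinearNE.
- by apply/collinearNE; rewrite -(collinear_map phiU pc pb pd); apply/collinearNE.
- exact: mulmx_unit_neq0.
have px := proj_eq_refl (phi *m x).
by split; [rewrite -(collinear_map phiU pa pb px)|rewrite -(collinear_map phiU pc pd px)].
Qed.

(** The point [w] only certifies that [u] and [v] span a line. If [x] and [y] represent the same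
    point, the conclusion is degenerate but still true. *)
Lemma collinear_join u v w x y : ~ collinear u v w ->
  collinear u v x -> collinear u v y -> collinear x y u /\ collinear x y v.
Proof.
move=> /collinearNE nd uvx uvy; rewrite /collinear.
have eu : det3 u v w * det3 x y u = det3 u x w * det3 u v y + det3 u v x * det3 w y u.
  by bracket.
have ev : det3 u v w * det3 x y v = det3 u v x * det3 w y v - det3 x v w * det3 u v y.
  by bracket.
move: eu ev; rewrite uvx uvy !mulr0 !mul0r addr0 subr0.
by split; apply: (mulfI nd); rewrite mulr0.
Qed.

(** * Affine normalisation, orientation and barycentric coordinates *)

Lemma aff_proj u v : proj_eq u v -> aff u = aff v.
Proof.
case=> c [c0 ->]; rewrite /aff mxE scalerA invfM mulrAC mulVf //.
by rewrite mul1r.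
Qed.

Lemma in_affine_proj u v : proj_eq u v -> in_affine v -> in_affine u.
Proof. by case=> c [c0 ->] v2; rewrite /in_affine mxE mulf_neq0. Qed.

Lemma proj_eq_aff u : in_affine u -> proj_eq u (aff u).
Proof.
move=> u2; exists (u 2%:R 0); split=> //.
by rewrite /aff scalerA divff // scale1r.
Qed.

Lemma aff_weight u : in_affine u -> aff u 2%:R 0 = 1.
Proof. by move=> u2; rewrite mxE mulVf. Qed.

(** Division by positive weights keeps signs, so orientations can be read on unnormalised lifts. *)
Lemma orient_gt0 u v w : 0 < u 2%:R 0 -> 0 < v 2%:R 0 -> 0 < w 2%:R 0 ->
  (0 < orient u v w) = (0 < det3 u v w).
Proof.
move=> u2 v2 w2; rewrite /orient /aff det3Zl det3Zm det3Zr.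
by rewrite !pmulr_rgt0 ?invr_gt0.
Qed.

(** By Cramer's rule the barycentric coordinates are quotients of brackets; they sum to 1 because
    all four affine lifts have last coordinate 1. *)
Lemma in_int_triE x u v w :
  in_affine x -> in_affine u -> in_affine v -> in_affine w -> 0 < orient u v w ->
  in_int_tri x u v w <->
  [/\ 0 < orient x v w, 0 < orient u x w & 0 < orient u v x].
Proof.
rewrite /in_int_tri /orient => /aff_weight x2 /aff_weight u2 /aff_weight v2 /aff_weight w2.
move: (aff x) (aff u) (aff v) (aff w) x2 u2 v2 w2 => {}x {}u {}v {}w x2 u2 v2 w2 D0.
split=> [[a [b [c [a0 [b0 [c0 [_ ->]]]]]]]|[xa xb xc]].
  split.
  - by rewrite (_ : det3 _ _ _ = a * det3 u v w) ?mulr_gt0 //; bracket.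
  - by rewrite (_ : det3 _ _ _ = b * det3 u v w) ?mulr_gt0 //; bracket.
  - by rewrite (_ : det3 _ _ _ = c * det3 u v w) ?mulr_gt0 //; bracket.
have e : x = (det3 x v w / det3 u v w) *: u + (det3 u x w / det3 u v w) *: v
             + (det3 u v x / det3 u v w) *: w.
  have := congr1 ( *:%R (det3 u v w)^-1) (det3_cramer u v w x).
  by rewrite !scalerDr !scalerA mulVf ?gt_eqF // scale1r ![_^-1 * _]mulrC.
exists (det3 x v w / det3 u v w), (det3 u x w / det3 u v w), (det3 u v x / det3 u v w).
rewrite !divr_gt0 //; do 4 split=> //.
by move/(congr1 (fun z : pt R => z 2%:R 0)): e; rewrite !mxE x2 u2 v2 w2 !mulr1.
Qed.

End Brackets.

(** * Sign conditions on four points and their images under the map and its inverse *)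

Section Cells.
Set Implicit Arguments. Unset Strict Implicit. Unset Printing Implicit Defensive.
Variables (R : realType) (s : R).
Hypothesis s2 : s * s = 1.
Implicit Types (u v w x y : pt R) (p q : int -> pt R) (N : int) (k : nat).

Lemma sgn_mul_gt0 (a b : R) : 0 < s * a -> 0 < s * b -> 0 < a * b.
Proof.
move=> a0 b0; have := mulr_gt0 a0 b0.
by rewrite mulrACA s2 mul1r.
Qed.

(* With x = P_{i+k} and y = P_{i+k+1}; s = 1 is type alpha, s = -1 type beta. *)
Definition cell u v x y : Prop :=
  [/\ 0 < det3 u v y, 0 < det3 u v x, 0 < s * det3 u x y & 0 < s * det3 x v y].

Definition tk_pt u v x y : pt R := x - (det3 x v y / det3 u v y) *: u.

(** The factor [s] selects the lift whose last coordinate is positive. *)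
Definition inv_tk_pt u v x y : pt R := s *: (x - (det3 u v x / det3 u v y) *: y).

(** Cramer's rule gives x = a u + b v + c y. Each image point thus has two expressions, one on each
    of its lines, and later proofs pick the one whose points recur in the neighbouring cells. *)
Lemma cell_coefs u v x y : cell u v x y -> exists a b c : R,
  [/\ 0 < s * a, 0 < s * b & 0 < c] /\
  [/\ tk_pt u v x y = x - a *: u, tk_pt u v x y = b *: v + c *: y,
      inv_tk_pt u v x y = s *: (x - c *: y) &
      inv_tk_pt u v x y = s *: (a *: u + b *: v)].
Proof.
case=> D0 xc xb xa; pose D := det3 u v y.
exists (det3 x v y / D), (det3 u x y / D), (det3 u v x / D).
have e : x = (det3 x v y / D) *: u + (det3 u x y / D) *: v + (det3 u v x / D) *: y.
  have := congr1 ( *:%R D^-1) (det3_cramer u v y x).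
  by rewrite !scalerDr !scalerA mulVf ?gt_eqF // scale1r ![_^-1 * _]mulrC.
split; first by rewrite !mulrA !divr_gt0.
have e1 : x - (det3 x v y / D) *: u = (det3 u x y / D) *: v + (det3 u v x / D) *: y.
  by rewrite {1}e addrAC (addrAC _ _ (- _)) subrr add0r.
have e2 : x - (det3 u v x / D) *: y = (det3 x v y / D) *: u + (det3 u x y / D) *: v.
  by rewrite {1}e addrK.
by split; rewrite /tk_pt /inv_tk_pt -/D -?e1 -?e2.
Qed.

(** The sign decides which expression is visibly positive: b v + c y if [s] is 1, and x - a u with a
    < 0 if [s] is -1. *)
Lemma tk_pt_weight u v x y : cell u v x y ->
  0 < u 2%:R 0 -> 0 < v 2%:R 0 -> 0 < x 2%:R 0 -> 0 < y 2%:R 0 ->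
  0 < tk_pt u v x y 2%:R 0.
Proof.
move=> /cell_coefs[a [b [c [[a0 b0 c0] [e1 e2 _ _]]]]] u0 v0 x0 y0.
have /orP[/eqP s1|/eqP s1] : (s == 1) || (s == -1) by rewrite -sqrf_eq1 expr2 s2.
  by move: b0; rewrite e2 !mxE s1 mul1r => b0; rewrite addr_gt0 // mulr_gt0.
by move: a0; rewrite e1 !mxE s1 mulN1r => a0; rewrite -mulNr addr_gt0 // mulr_gt0.
Qed.

Lemma inv_tk_pt_weight u v x y : cell u v x y ->
  0 < u 2%:R 0 -> 0 < v 2%:R 0 -> 0 < inv_tk_pt u v x y 2%:R 0.
Proof.
move=> /cell_coefs[a [b [c [[a0 b0 c0] [_ _ _ ->]]]]] u0 v0.
by rewrite !mxE mulrDr !mulrA addr_gt0 // mulr_gt0.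
Qed.

Lemma meets_tk_pt u v x y : cell u v x y -> meets u x v y (tk_pt u v x y).
Proof.
move=> /cell_coefs[a [b [c [_ [e1 e2 _ _]]]]]; rewrite /meets /collinear.
by split; [rewrite e1|rewrite e2]; bracket.
Qed.

Lemma meets_inv_tk_pt u v x y : cell u v x y -> meets u v x y (inv_tk_pt u v x y).
Proof.
move=> /cell_coefs[a [b [c [_ [_ _ e1 e2]]]]]; rewrite /meets /collinear.
by split; [rewrite e2|rewrite e1]; bracket.
Qed.

(** Both summands of the Pluecker relation have the sign of [s]; this links the diagonal bracket X =
    [A, C, E] to the convexity bracket Y = [Y, C, D]. *)
Lemma cell_turn (A C D E Y : pt R) :
  0 < s * det3 A C D -> 0 < s * det3 A C Y -> 0 < det3 Y C E -> 0 < det3 C D E ->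
  0 < s * (det3 A C E * det3 Y C D).
Proof.
move=> h1 h2 h3 h4; rewrite det3_plucker mulrDr !mulrA.
by rewrite addr_gt0 // mulr_gt0.
Qed.

Lemma cell_a_gt0 u v x y : cell u v x y -> 0 < s * det3 v y x.
Proof. by case=> _ _ _; rewrite (_ : det3 x v y = det3 v y x) //; bracket. Qed.

(** The first two vertices of the image cell lie on the line [p1 pk1], the last two on [pk1 q1].
    Hence all its brackets are multiples of [p1, pk1, q1], whose sign comes from [conv] through
    [cell_turn]. *)
Lemma tk_pt_cells (p0 p1 p2 p3 pk pk1 pk2 pk3 q0 q1 q2 : pt R) :
  cell p0 p1 pk pk1 -> cell p1 p2 pk1 pk2 -> cell p2 p3 pk2 pk3 ->
  cell pk pk1 q0 q1 -> cell pk1 pk2 q1 q2 -> 0 < det3 pk pk1 pk2 ->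
  0 < det3 (tk_pt p0 p1 pk pk1) (tk_pt p1 p2 pk1 pk2) (tk_pt p2 p3 pk2 pk3) /\
  cell (tk_pt p0 p1 pk pk1) (tk_pt p1 p2 pk1 pk2)
       (tk_pt pk pk1 q0 q1) (tk_pt pk1 pk2 q1 q2).
Proof.
move=> C0 C1 C2 Ck Ck1 conv.
have key : 0 < s * det3 p1 pk1 q1.
  rewrite -(pmulr_lgt0 _ conv) -mulrA; apply: cell_turn.
  - by case: C1.
  - exact: cell_a_gt0 C0.
  - by case: Ck.
  - by case: Ck1.
have [_ p1_x p1_b _] := C1.
have [a [b [c [[a0 b0 c0] [_ -> _ _]]]]] := cell_coefs C0.
have [a1 [b1 [c1 [[a10 b10 c10] [-> _ _ _]]]]] := cell_coefs C1.
have [a2 [b2 [c2 [[a20 b20 c20] [-> _ _ _]]]]] := cell_coefs C2.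
have [a3 [b3 [c3 [[a30 b30 c30] [_ -> _ _]]]]] := cell_coefs Ck.
have [a4 [b4 [c4 [[a40 b40 c40] [-> _ _ _]]]]] := cell_coefs Ck1.
(* [L0] and [L1] sign the 2 x 2 determinants of the two pairs of image points, written in the bases
   (p1, pk1) and (pk1, q1). *)
have L0 : 0 < s * (b + c * a1) by rewrite mulrDr mulrCA addr_gt0 // mulr_gt0.
have L1 : 0 < s * (b3 + c3 * a4) by rewrite mulrDr mulrCA addr_gt0 // mulr_gt0.
have LX := sgn_mul_gt0 L0 key.
have LX' := sgn_mul_gt0 L1 key.
split; last split.
- rewrite (_ : det3 _ _ _ = (b + c * a1) * (det3 p1 pk1 pk2 + a2 * det3 p1 p2 pk1)); last by bracket.
  by rewrite sgn_mul_gt0 // mulrDr mulrA addr_gt0 // mulr_gt0.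
- by rewrite (_ : det3 _ _ _ = (b + c * a1) * det3 p1 pk1 q1) //; bracket.
- rewrite (_ : det3 _ _ _ = c3 * ((b + c * a1) * det3 p1 pk1 q1)); last by bracket.
  by rewrite mulr_gt0.
- rewrite (_ : det3 _ _ _ = b * ((b3 + c3 * a4) * det3 p1 pk1 q1)); last by bracket.
  by rewrite mulrA mulr_gt0.
- rewrite (_ : det3 _ _ _ = a1 * ((b3 + c3 * a4) * det3 p1 pk1 q1)); last by bracket.
  by rewrite mulrA mulr_gt0.
Qed.

(** The first and third image points lie on the line [qk qk1], the other two on [qk1 qk2], so every
    bracket is a multiple of [qk, qk1, qk2], positive by convexity of the source. *)
Lemma inv_tk_pt_cell (q0 q1 q2 qk qk1 qk2 r0 r1 r2 : pt R) :
  cell q0 q1 qk qk1 -> cell q1 q2 qk1 qk2 -> cell qk qk1 r0 r1 -> cell qk1 qk2 r1 r2 ->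
  0 < det3 qk qk1 qk2 ->
  cell (inv_tk_pt q0 q1 qk qk1) (inv_tk_pt q1 q2 qk1 qk2)
       (inv_tk_pt qk qk1 r0 r1) (inv_tk_pt qk1 qk2 r1 r2).
Proof.
move=> C0 C1 Ck Ck1 conv.
have [a [b [c [[a0 b0 c0] [_ _ -> _]]]]] := cell_coefs C0.
have [a1 [b1 [c1 [[a10 b10 c10] [_ _ -> _]]]]] := cell_coefs C1.
have [a3 [b3 [c3 [[a30 b30 c30] [_ _ _ ->]]]]] := cell_coefs Ck.
have [a4 [b4 [c4 [[a40 b40 c40] [_ _ _ ->]]]]] := cell_coefs Ck1.
have L0 : 0 < s * (b3 + c * a3) by rewrite mulrDr mulrCA addr_gt0 // mulr_gt0.
have L1 : 0 < s * (b4 + c1 * a4) by rewrite mulrDr mulrCA addr_gt0 // mulr_gt0.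
split.
- rewrite (_ : det3 _ _ _ = (s * s) * (s * (b4 + c1 * a4)) * det3 qk qk1 qk2); last by bracket.
  by rewrite s2 mul1r mulr_gt0.
- rewrite (_ : det3 _ _ _ = (s * s) * (c1 * (s * (b3 + c * a3))) * det3 qk qk1 qk2); last by bracket.
  by do !(rewrite ?s2 ?mul1r; apply: mulr_gt0 => //).
- rewrite (_ : s * det3 _ _ _ =
     (s * s) * ((s * (b3 + c * a3)) * (s * b4)) * det3 qk qk1 qk2); last by bracket.
  by do !(rewrite ?s2 ?mul1r; apply: mulr_gt0 => //).
- rewrite (_ : s * det3 _ _ _ =
     (s * s) * ((s * a3) * (s * (b4 + c1 * a4))) * det3 qk qk1 qk2); last by bracket.
  by do !(rewrite ?s2 ?mul1r; apply: mulr_gt0 => //).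
Qed.

(** * Sequences of lifts in a fixed chart *)

(* [p] consists of lifts with positive last coordinate, not normalised to 1. *)
Definition spiral_from k N p : Prop := forall i, N <= i ->
  [/\ 0 < p i 2%:R 0, 0 < det3 (p i) (p (i + 1)) (p (i + 2)) &
      cell (p i) (p (i + 1)) (p (i + k%:Z)) (p (i + k%:Z + 1))].

Definition tk_seq k p i := tk_pt (p i) (p (i + 1)) (p (i + k%:Z)) (p (i + k%:Z + 1)).

(* Indexed so that [inv_tk_seq k p i] is the point T_k^{-1}(p)_{i+k+1}. *)
Definition inv_tk_seq k p i :=
  inv_tk_pt (p i) (p (i + 1)) (p (i + k%:Z)) (p (i + k%:Z + 1)).

(** Normal forms of the indices, so that neighbouring cells share their points syntactically. *)
Lemma index_shifts (i j : int) :
  [/\ i + 1 + 1 = i + 2, i + 1 + j = i + j + 1, i + 2 + j = i + j + 2,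
      i + j + 1 + 1 = i + j + 2 & i + j + 1 + j = i + j + j + 1].
Proof. by split; ring. Qed.

Lemma spiral_from_tk_seq k N p : spiral_from k N p -> spiral_from k N (tk_seq k p).
Proof.
move=> Hp i Ni.
have [w0 _ C0] := Hp i Ni.
have /Hp[w1 _ C1] : N <= i + 1 by lia.
have /Hp[_ _ C2] : N <= i + 2 by lia.
have /Hp[wk conv Ck] : N <= i + k%:Z by lia.
have /Hp[wk1 _ Ck1] : N <= i + k%:Z + 1 by lia.
have [E1 E2 E3 E4 E5] := index_shifts i k%:Z.
have w : 0 < tk_seq k p i 2%:R 0 by exact: tk_pt_weight.
rewrite !(E1, E2, E3, E4, E5) in C1 C2 Ck Ck1.
have := tk_pt_cells C0 C1 C2 Ck Ck1 conv.
by rewrite /tk_seq !(E1, E2, E3, E4, E5) => -[].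
Qed.

(** This is the bracket X of the inverse image. Its first two points lie on the line [qk qk1]; the
    third combines [r0] and [r1], both on the positive side of that line, with coefficients of the
    sign of [s]. *)
Lemma inv_tk_pt_diag (q0 q1 qk qk1 r0 r1 t0 t1 : pt R) :
  cell q0 q1 qk qk1 -> cell qk qk1 r0 r1 -> cell r0 r1 t0 t1 ->
  0 < s * det3 (inv_tk_pt q0 q1 qk qk1) (inv_tk_pt qk qk1 r0 r1) (inv_tk_pt r0 r1 t0 t1).
Proof.
move=> C0 Ck C2k.
have [a [b [c [[a0 b0 c0] [_ _ -> _]]]]] := cell_coefs C0.
have [a3 [b3 [c3 [[a30 b30 c30] [_ _ _ ->]]]]] := cell_coefs Ck.
have [a4 [b4 [c4 [[a40 b40 c40] [_ _ _ ->]]]]] := cell_coefs C2k.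
have L0 : 0 < s * (b3 + c * a3) by rewrite mulrDr mulrCA addr_gt0 // mulr_gt0.
have [r1_gt0 r0_gt0 _ _] := Ck.
rewrite (_ : s * det3 _ _ _ = (s * s) * ((s * (b3 + c * a3)) *
  (s * a4 * det3 qk qk1 r0 + s * b4 * det3 qk qk1 r1))); last by bracket.
by rewrite s2 mul1r mulr_gt0 // addr_gt0 // mulr_gt0.
Qed.

(* Convexity at [i] is read off from the cells starting at [i - k], whence the loss of [k] indices. *)
Lemma spiral_from_inv_tk_seq k N p :
  spiral_from k N p -> spiral_from k (N + k%:Z) (inv_tk_seq k p).
Proof.
move=> Hp.
have cells j : N <= j -> cell (inv_tk_seq k p j) (inv_tk_seq k p (j + 1))
    (inv_tk_seq k p (j + k%:Z)) (inv_tk_seq k p (j + k%:Z + 1)).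
  move=> Nj; have [_ _ C0] := Hp j Nj.
  have /Hp[_ _ C1] : N <= j + 1 by lia.
  have /Hp[_ conv Ck] : N <= j + k%:Z by lia.
  have /Hp[_ _ Ck1] : N <= j + k%:Z + 1 by lia.
  have [E1 E2 E3 E4 E5] := index_shifts j k%:Z.
  rewrite !(E1, E2, E3, E4, E5) in C1 Ck Ck1.
  have := inv_tk_pt_cell C0 C1 Ck Ck1 conv.
  by rewrite /inv_tk_seq !(E1, E2, E3, E4, E5).
move=> i Ni; split; last by apply: cells; lia.
  have /Hp[w0 _ C0] : N <= i by lia.
  have /Hp[w1 _ _] : N <= i + 1 by lia.
  exact: inv_tk_pt_weight.
have [m -> Nm] : exists2 m, i = m + k%:Z & N <= m by exists (i - k%:Z); lia.
have C0 := cells m Nm.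
have /cells C1 : N <= m + 1 by lia.
have /cells Ck : N <= m + k%:Z by lia.
have /cells Ck1 : N <= m + k%:Z + 1 by lia.
have diag : 0 < s * det3 (inv_tk_seq k p (m + 1)) (inv_tk_seq k p (m + k%:Z + 1))
    (inv_tk_seq k p (m + k%:Z + k%:Z + 1)).
  have /Hp[_ _ D0] : N <= m + 1 by lia.
  have /Hp[_ _ D1] : N <= m + k%:Z + 1 by lia.
  have /Hp[_ _ D2] : N <= m + k%:Z + k%:Z + 1 by lia.
  have F1 j : j + 1 + k%:Z = j + k%:Z + 1 by ring.
  rewrite !F1 in D0 D1 D2.
  by have := inv_tk_pt_diag D0 D1 D2; rewrite /inv_tk_seq !F1.
have [E1 E2 E3 E4 E5] := index_shifts m k%:Z.
rewrite !(E1, E2, E3, E4, E5) in C0 C1 Ck Ck1.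
(* Here X is the known factor ([diag]) and convexity is deduced, the reverse of the argument in
   [tk_pt_cells]. *)
rewrite -(pmulr_rgt0 _ diag) -mulrA; apply: cell_turn.
- by case: C1.
- exact: cell_a_gt0 C0.
- by case: Ck.
- by case: Ck1.
Qed.

(** Common form of both types; general position is derived from it below. The lifts [p] are tied to
    [P] only from [N] on, since earlier points may leave the affine chart. *)
Definition spiral k n P : Prop :=
  [/\ forall i, P i != 0,
      exists M : 'M[R]_3, M \in unitmx /\
        forall i, proj_eq (P (i + n%:Z)) (M *m P i) &
      forall N : int, exists (phi : 'M[R]_3) p, [/\ phi \in unitmx,
        forall i, N <= i -> proj_eq (phi *m P i) (p i) & spiral_from k N p]].

(** Each index [i] is covered by the representative for N = i, and projective maps preserve
    collinearity. *)
Lemma spiral_noncollinear k n P : spiral k n P ->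
  forall i, ~ collinear (P i) (P (i + 1)) (P (i + 2)).
Proof.
case=> _ _ reps i; have [phi [p [phiU pP /(_ i (lexx i))[_ conv _]]]] := reps i.
rewrite (collinear_map phiU (pP i _) (pP (i + 1) _) (pP (i + 2) _)); [|lia..].
by apply/collinearNE; rewrite gt_eqF.
Qed.

Lemma sgn_gt0_neq0 (a : R) : 0 < s * a -> a != 0.
Proof. by move/lt0r_neq0; apply: contra_neq => ->; rewrite mulr0. Qed.

Lemma spiral_k_nice k n P : spiral k n P -> k_nice k P.
Proof.
case=> _ _ reps i; have [phi [p [phiU pP /(_ i (lexx i))[_ _ C]]]] := reps i.
have lift j l m : i <= j -> i <= l -> i <= m ->
    det3 (p j) (p l) (p m) != 0 -> ~ collinear (P j) (P l) (P m).
  move=> ij il im /collinearNE.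
  by rewrite -(collinear_map phiU (pP j ij) (pP l il) (pP m im)).
have c4 := cell_a_gt0 C; case: C => c1 c2 c3 _.
split; [|split; [|split]]; (apply: lift; try lia).
- exact: lt0r_neq0.
- exact: lt0r_neq0.
- exact: sgn_gt0_neq0.
- by have [] := det3_swap_neq0 (sgn_gt0_neq0 c4).
Qed.

(** Treats the map, with offsets (k, 1), and its inverse, with offsets (1, k), together. Uniqueness
    of intersection points carries the monodromy and the chart from [P] to [Q]; the bound [N']
    leaves room for a loss of indices. *)
Lemma spiral_meets k n P Q (o1 o2 : int) : 0 <= o1 -> 0 <= o2 ->
  spiral k n P -> (forall i, Q i != 0) ->
  (forall i, meets (P i) (P (i + o1)) (P (i + o2)) (P (i + k%:Z + 1)) (Q i)) ->
  (forall i, det3 (P i) (P (i + o2)) (P (i + o1)) != 0) ->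
  (forall i, det3 (P (i + o2)) (P (i + o1)) (P (i + k%:Z + 1)) != 0) ->
  (forall N, exists2 N', N' <= N & forall p, spiral_from k N' p ->
     exists2 q, spiral_from k N q & forall i, N <= i ->
       meets (p i) (p (i + o1)) (p (i + o2)) (p (i + k%:Z + 1)) (q i)) ->
  spiral k n Q.
Proof.
move=> o10 o20 [P0 [M [MU PM]] reps] Q0 QP nd1 nd2 step.
split=> //.
  exists M; split=> // i; apply: proj_eq_sym.
  have PM' j : proj_eq (M *m P j) (P (j + n%:Z)) by apply: proj_eq_sym.
  apply: (meets_map_uniq MU (PM' _) (PM' _) (PM' _) (PM' _) _ _ _ _ (QP i)) => //.
  have := QP (i + n%:Z).
  by rewrite 2![i + n%:Z + _]addrAC [_ + k%:Z]addrAC [i + _ + _ + 1]addrAC.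
move=> N; have [N' N'N stepN] := step N.
have [phi [p [phiU pP Hp]]] := reps N'.
have [q Hq qp] := stepN p Hp.
exists phi, q; split=> // i Ni.
apply: (meets_map_uniq phiU (pP _ _) (pP _ _) (pP _ _) (pP _ _) _ _ _ _ (QP i) (qp i Ni)) => //; try lia.
by have [/lt0r_neq0 + _ _] := Hq i Ni; apply: contra_neq => ->; rewrite mxE.
Qed.

Lemma spiral_tk k n P Q : spiral k n P -> is_Tk k P Q -> spiral k n Q.
Proof.
move=> HP TkQ; have nice := spiral_k_nice HP.
apply: (@spiral_meets k n P Q k%:Z 1) => //.
- by move=> i; case: (TkQ i).
- by move=> i; case: (TkQ i) => _ [].
- by move=> i; apply/collinearNE; case: (nice i).
- by move=> i; apply/collinearNE; case: (nice i) => _ [_ []].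
move=> N; exists N => // p Hp; exists (tk_seq k p); first exact: spiral_from_tk_seq.
by move=> i Ni; apply: meets_tk_pt; case: (Hp i Ni).
Qed.

(** Indexed like [inv_tk_seq]: the value at [i] is the preimage point of index i + k + 1. *)
Definition inv_tk k Q : polygon R :=
  fun i => meet (Q i) (Q (i + 1)) (Q (i + k%:Z)) (Q (i + k%:Z + 1)).

Lemma spiral_inv_tk k n Q : spiral k n Q -> spiral k n (inv_tk k Q).
Proof.
move=> HQ; have nice := spiral_k_nice HQ.
have nd1 i : det3 (Q i) (Q (i + k%:Z)) (Q (i + 1)) != 0.
  by have [/collinearNE/det3_swap_neq0[]] := nice i.
have nd2 i : det3 (Q (i + k%:Z)) (Q (i + 1)) (Q (i + k%:Z + 1)) != 0.
  by have [_ [_ [_ /collinearNE/det3_swap_neq0[]]]] := nice i.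
apply: (@spiral_meets k n Q _ 1 k%:Z) => //.
- by move=> i; apply: meet_neq0.
- by move=> i; apply: meets_meet.
(* Starting k indices earlier makes up for the loss in [spiral_from_inv_tk_seq]. *)
move=> N; exists (N - k%:Z); first by lia.
move=> p Hp; exists (inv_tk_seq k p).
  by rewrite -[N](subrK k%:Z); apply: spiral_from_inv_tk_seq.
by move=> i Ni; have /Hp[_ _ /meets_inv_tk_pt] : N - k%:Z <= i by lia.
Qed.

(** Representatives exist for every bound, so N + j serves the shifted sequence. This undoes the
    offset in [inv_tk]. *)
Lemma spiral_shift k n P (j : int) : spiral k n P -> spiral k n (fun i => P (i + j)).
Proof.
case=> P0 [M [MU PM]] reps; split=> [//||N].
  by exists M; split=> // i; rewrite addrAC.
have [phi [p [phiU pP Hp]]] := reps (N + j).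
exists phi, (fun i => p (i + j)); split=> // [i Ni|i Ni]; first by apply: pP; lia.
have /Hp[w conv C] : N + j <= i + j by lia.
by rewrite !(addrAC _ _ j).
Qed.

(** With P_i the value of [inv_tk] at i - k - 1, both P_i and P_{i+k} lie on Q_{i-1} Q_i, and both
    P_{i+1} and P_{i+k+1} on Q_i Q_{i+1}. The two lines defining the image therefore pass through
    Q_i. *)
Lemma spiral_tk_surj k n Q : spiral k n Q ->
  exists2 P, spiral k n P & is_Tk k P Q.
Proof.
move=> HQ; exists (fun i => inv_tk k Q (i + (- (k%:Z + 1)))).
  exact/spiral_shift/spiral_inv_tk.
have nice := spiral_k_nice HQ.
have on_line i : collinear (Q i) (Q (i + 1)) (inv_tk k Q i) /\
    collinear (Q (i + k%:Z)) (Q (i + k%:Z + 1)) (inv_tk k Q i) by exact: meets_meet.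
have nc := spiral_noncollinear HQ.
move=> i; have [Q0 _ _] := HQ; split=> //; split.
  have [_ l1] := on_line (i - (k%:Z + 1)).
  have [l2 _] := on_line (i - 1).
  rewrite (_ : i - (k%:Z + 1) + k%:Z = i - 1) in l1; last by ring.
  have [_] := collinear_join (nc (i - 1)) l1 l2.
  by rewrite subrK (_ : i + k%:Z - (k%:Z + 1) = i - 1) //; ring.
have [_ l1] := on_line (i - k%:Z).
have [l2 _] := on_line i.
rewrite subrK in l1.
have [+ _] := collinear_join (nc i) l1 l2.
rewrite (_ : i + 1 - (k%:Z + 1) = i - k%:Z); last by ring.
by rewrite (_ : i + k%:Z + 1 - (k%:Z + 1) = i) //; ring.
Qed.

End Cells.

(** * Translation between the two spiral types and the signed form *)

Section Representatives.
Set Implicit Arguments. Unset Strict Implicit. Unset Printing Implicit Defensive.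
Variable R : realType.
Implicit Types (p P Q : polygon R) (N : int) (k n : nat).

(** The explicit factor -1 matches the [s] of [cell] in type beta. *)
Lemma det3_swap23 (u v w : pt R) : det3 u v w = - 1 * det3 u w v.
Proof. by bracket. Qed.

Lemma det3_swap13 (u v w : pt R) : det3 u v w = - 1 * det3 w v u.
Proof. by bracket. Qed.

Lemma in_int_tri_det (x u v w : pt R) :
  0 < x 2%:R 0 -> 0 < u 2%:R 0 -> 0 < v 2%:R 0 -> 0 < w 2%:R 0 -> 0 < det3 u v w ->
  in_int_tri x u v w <-> [/\ 0 < det3 x v w, 0 < det3 u x w & 0 < det3 u v x].
Proof.
move=> x0 u0 v0 w0 o; rewrite -(orient_gt0 x0 v0 w0) -(orient_gt0 u0 x0 w0) -(orient_gt0 u0 v0 x0).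
by apply: in_int_triE; rewrite ?orient_gt0 //; apply: lt0r_neq0.
Qed.

Lemma N_rep_alphaE k N p : (forall i, N <= i -> 0 < p i 2%:R 0) ->
  N_rep_alpha k N p <-> spiral_from 1 k N p.
Proof.
move=> w; split=> Hp i Ni; have := Hp i Ni; rewrite /positive_triple /cell !mul1r.
all: have [w0 w1 w2] : [/\ 0 < p i 2%:R 0, 0 < p (i + 1) 2%:R 0 & 0 < p (i + 2) 2%:R 0]
  by split; apply: w; lia.
all: have [wk wk1] : 0 < p (i + k%:Z) 2%:R 0 /\ 0 < p (i + k%:Z + 1) 2%:R 0
  by split; apply: w; lia.
- rewrite !orient_gt0 // => -[_ [c1 [c2 c3]]]; move: c3.
  by rewrite in_int_tri_det // => -[].
- rewrite !orient_gt0 // => -[_ c1 [c2 c3 c4 c5]].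
  by rewrite in_int_tri_det //; split=> //; apply: lt0r_neq0.
Qed.

(** Type beta exchanges P_{i+k} and P_{i+k+1}; this negates exactly the two brackets that contain
    both, which are those carrying [s]. *)
Lemma N_rep_betaE k N p : (forall i, N <= i -> 0 < p i 2%:R 0) ->
  N_rep_beta k N p <-> spiral_from (- 1) k N p.
Proof.
move=> w; split=> Hp i Ni; have := Hp i Ni; rewrite /positive_triple /cell -det3_swap23 -det3_swap13.
all: have [w0 w1 w2] : [/\ 0 < p i 2%:R 0, 0 < p (i + 1) 2%:R 0 & 0 < p (i + 2) 2%:R 0]
  by split; apply: w; lia.
all: have [wk wk1] : 0 < p (i + k%:Z) 2%:R 0 /\ 0 < p (i + k%:Z + 1) 2%:R 0
  by split; apply: w; lia.
- rewrite !orient_gt0 // => -[_ [c1 [c2 c3]]]; move: c3.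
  by rewrite in_int_tri_det // => -[].
- rewrite !orient_gt0 // => -[_ c1 [c2 c3 c4 c5]].
  by rewrite in_int_tri_det //; split=> //; apply: lt0r_neq0.
Qed.

Lemma N_rep_alpha_proj k N P Q : (forall i, N <= i -> proj_eq (P i) (Q i)) ->
  N_rep_alpha k N Q -> N_rep_alpha k N P.
Proof.
move=> PQ HQ i Ni; have [c0 c1] := HQ i Ni.
split; first exact: in_affine_proj (PQ i Ni) c0.
move: c1; rewrite /positive_triple /orient /in_int_tri.
have e j : N <= j -> aff (P j) = aff (Q j) by move=> Nj; apply/aff_proj/PQ.
by rewrite !e //; lia.
Qed.

Lemma N_rep_beta_proj k N P Q : (forall i, N <= i -> proj_eq (P i) (Q i)) ->
  N_rep_beta k N Q -> N_rep_beta k N P.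
Proof.
move=> PQ HQ i Ni; have [c0 c1] := HQ i Ni.
split; first exact: in_affine_proj (PQ i Ni) c0.
move: c1; rewrite /positive_triple /orient /in_int_tri.
have e j : N <= j -> aff (P j) = aff (Q j) by move=> Nj; apply/aff_proj/PQ.
by rewrite !e //; lia.
Qed.

(** [rep] stands for either kind of N-representative, so that both types share one proof. *)
Lemma spiral_of_reps (s : R) k n P (rep : int -> polygon R -> Prop) :
  (forall N Q, rep N Q -> forall i, N <= i -> in_affine (Q i)) ->
  (forall N P Q, (forall i, N <= i -> proj_eq (P i) (Q i)) -> rep N Q -> rep N P) ->
  (forall N p, (forall i, N <= i -> 0 < p i 2%:R 0) ->
     rep N p <-> spiral_from s k N p) ->
  s * s = 1 ->
  twisted_ngon n P /\ k_nice k P /\ (forall N, exists Q, equiv_poly P Q /\ rep N Q) <->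
  spiral s k n P.
Proof.
move=> repA repP repE s2; split=> [[[P0 [_ PM]] [_ reps]]|HP].
  split=> // N; have [Q [[phi [phiU PQ]] HQ]] := reps N.
  have QA := repA _ _ HQ.
  have QQ i : N <= i -> proj_eq (Q i) (aff (Q i)) by move=> Ni; apply/proj_eq_aff/QA.
  (* Normalised lifts have weight 1, hence positive weight. *)
  exists phi, (fun i => aff (Q i)); split=> // [i Ni|].
    exact: proj_eq_trans (PQ i) (QQ i Ni).
  rewrite -repE => [|i Ni]; last by rewrite aff_weight ?ltr01 //; apply: QA.
  by apply: repP HQ => i Ni; apply/proj_eq_sym/QQ.
have [P0 PM reps] := HP.
split; first by split=> //; split=> //; apply: spiral_noncollinear HP.
split; first exact: spiral_k_nice HP.
move=> N; have [phi [p [phiU pP Hp]]] := reps N.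
(* Equivalence concerns all indices, while [p] is controlled only from [N] on; hence the witness is
   the transform of [P] itself. *)
exists (fun i => phi *m P i); split.
  by exists phi; split=> // i; apply: proj_eq_refl.
by apply: repP pP _; rewrite repE // => i /Hp[].
Qed.

Lemma spiral_alphaE k n P : spiral_alpha k n P <-> spiral 1 k n P.
Proof.
apply: spiral_of_reps; last by rewrite mulr1.
- by move=> N Q HQ i /HQ[].
- exact: N_rep_alpha_proj.
- exact: N_rep_alphaE.
Qed.

Lemma spiral_betaE k n P : spiral_beta k n P <-> spiral (- 1) k n P.
Proof.
apply: spiral_of_reps; last by rewrite mulrNN mulr1.
- by move=> N Q HQ i /HQ[].
- exact: N_rep_beta_proj.
- exact: N_rep_betaE.
Qed.

Lemma equiv_poly_refl P : equiv_poly P P.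
Proof.
by exists 1%:M; rewrite unitmx1; split=> // i; rewrite mul1mx; apply: proj_eq_refl.
Qed.

End Representatives.

Theorem mainTheorem1 (R : realType) (n k : nat) :
  (2 <= n)%N -> (3 <= k)%N ->
  (* T_k(S^alpha) = S^alpha *)
  ((forall P Q : polygon R, spiral_alpha k n P -> is_Tk k P Q -> spiral_alpha k n Q) /\
   (forall Q : polygon R, spiral_alpha k n Q ->
      exists P Q' : polygon R, spiral_alpha k n P /\ is_Tk k P Q' /\ equiv_poly Q' Q)) /\
  (* T_k(S^beta) = S^beta *)
  ((forall P Q : polygon R, spiral_beta k n P -> is_Tk k P Q -> spiral_beta k n Q) /\
   (forall Q : polygon R, spiral_beta k n Q ->
      exists P Q' : polygon R, spiral_beta k n P /\ is_Tk k P Q' /\ equiv_poly Q' Q)).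
Proof.
move=> _ _; have s1 : 1 * 1 = 1 :> R by rewrite mulr1.
have sN1 : -1 * -1 = 1 :> R by rewrite mulrNN mulr1.
split; split=> [P Q|Q].
- by move=> /spiral_alphaE HP TkQ; apply/spiral_alphaE; apply: spiral_tk HP TkQ.
- move=> /spiral_alphaE /(spiral_tk_surj s1)[P HP TkQ]; exists P, Q.
  by split; [apply/spiral_alphaE|split; last exact: equiv_poly_refl].
- by move=> /spiral_betaE HP TkQ; apply/spiral_betaE; apply: spiral_tk HP TkQ.
- move=> /spiral_betaE /(spiral_tk_surj sN1)[P HP TkQ]; exists P, Q.
  by split; [apply/spiral_betaE|split; last exact: equiv_poly_refl].
Qed.
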